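(* If $A,B$ are nonempty sets of vertices in the hypercube $\mathbb{H}_d$ and $C$ is the convex closure of $\widehat{m}(A,B)$, then $A\cup B\subseteq C$.
   Context: $\mathbb{H}_d$ is the hypercube: its points are the subsets of $\{1,\ldots,d\}$, with distance $d(\gamma,\gamma')=|\gamma\triangle\gamma'|$. For points $a,b$, $$\widehat{m}(a,b)=\{u: d(a,u)=\lfloor d(a,b)/2\rfloor,\ d(a,u)+d(u,b)=d(a,b)\}\cup\{u: d(a,u)=\lceil d(a,b)/2\rceil,\ d(a,u)+d(u,b)=d(a,b)\},$$ and $\widehat{m}(S,T)=\bigcup_{s\in S,t\in T}\widehat{m}(s,t)$. A set $S$ is convex if $\widehat{m}(S,S)\subseteq S$. The convex closure of a set is the smallest convex set containing it (the intersection of all convex sets containing it). *)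

(* Defs.v *)
From mathcomp Require Import all_boot.

Set Implicit Arguments.
Unset Strict Implicit.
Unset Printing Implicit Defensive.

(* The coordinates {1, ..., d} are indexed by 'I_d, i.e. shifted to start at 0. *)
Definition hypercube (d : nat) : finType := {set 'I_d}.

Definition hdist (d : nat) (a b : hypercube d) : nat :=
  #|(a :\: b) :|: (b :\: a)|.

(* n./2 and uphalf n are the floor and the ceiling of n / 2. *)
Definition midpoints (d : nat) (a b : hypercube d) : {set hypercube d} :=
  [set u | (hdist a u == (hdist a b)./2)
           && (hdist a u + hdist u b == hdist a b)]
  :|: [set u | (hdist a u == uphalf (hdist a b))
               && (hdist a u + hdist u b == hdist a b)].

Definition midpoint_set (d : nat) (S T : {set hypercube d}) :
    {set hypercube d} :=
  \bigcup_(s in S) \bigcup_(t in T) midpoints s t.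

Definition convex (d : nat) (S : {set hypercube d}) : bool :=
  midpoint_set S S \subset S.

Definition convex_closure (d : nat) (X : {set hypercube d}) :
    {set hypercube d} :=
  \bigcap_(S : {set hypercube d} | convex S && (X \subset S)) S.

(* Main.v *)
Require Import Defs.
From mathcomp Require Import all_boot.

(** For [a] and [b] differing exactly on the coordinates [D], flip half of [D]
    in both points: this gives midpoints [u] and [v] of [a] and [b] which again
    differ exactly on [D], and [a] and [b] are in turn midpoints of [u] and [v].
    So a convex set containing the midpoints of [a] and [b] contains [a] and [b]. *)

Lemma subset_of_card (T : finType) (D : {set T}) (k : nat) :
  k <= #|D| -> exists2 W : {set T}, W \subset D & #|W| = k.
Proof.
(* The [k]-subsets of [D] are counted by a binomial coefficient, which is positive exactly when
   [k <= #|D|]. *)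
rewrite -bin_gt0 -cards_draws => /card_gt0P[W].
by rewrite inE => /andP[sWD /eqP cW]; exists W.
Qed.

Lemma hdistC (d : nat) (a b : hypercube d) : hdist a b = hdist b a.
Proof. by rewrite /hdist setUC. Qed.

Lemma uphalf_subn (n : nat) : n - n./2 = uphalf n.
Proof.
by rewrite -{1}(odd_double_half n) uphalf_half -addnn addnA addnK.
Qed.

Lemma half_add_uphalf (n : nat) : n./2 + uphalf n = n.
Proof. by rewrite uphalf_half addnCA addnn odd_double_half. Qed.

Lemma midpoints_half (d : nat) (a b u : hypercube d) :
  hdist a u = (hdist a b)./2 -> hdist u b = uphalf (hdist a b) ->
  u \in midpoints a b.
Proof. by move=> au ub; rewrite !inE au ub half_add_uphalf !eqxx. Qed.

Lemma midpoints_uphalf (d : nat) (a b u : hypercube d) :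
  hdist a u = uphalf (hdist a b) -> hdist u b = (hdist a b)./2 ->
  u \in midpoints a b.
Proof.
by move=> au ub; rewrite !inE au ub addnC half_add_uphalf !eqxx orbT.
Qed.

Lemma half_flip (d : nat) (a b : hypercube d) :
  exists u v : hypercube d,
    [/\ hdist u v = hdist a b,
        hdist a u = (hdist a b)./2, hdist b v = (hdist a b)./2,
        hdist a v = uphalf (hdist a b) & hdist b u = uphalf (hdist a b)].
Proof.
pose D := (a :\: b) :|: (b :\: a).
have le_half : #|D|./2 <= #|D| by rewrite -{2}(half_add_uphalf #|D|) leq_addr.
have [W sWD cW] := subset_of_card _ _ _ le_half.
have cDW : #|D :\: W| = uphalf #|D| by rewrite cardsDS // cW uphalf_subn.
(* The witnesses are the symmetric differences of [a] and [b] with [W]: each point differs from its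
   own flip on [W], and from the flip of the other on [D :\: W]. *)
exists ((a :\: W) :|: (W :\: a)), ((b :\: W) :|: (W :\: b)).
(* With the halves written as cardinals of [W] and [D :\: W], each equation follows from an equality
   of sets, checked at each coordinate; [sWD] excludes coordinates of [W] where [a] and [b]
   agree. *)
rewrite /hdist -/D -cDW -cW; split; apply: eq_card => i;
  by move/subsetP/(_ i): sWD; rewrite !inE;
     case: (i \in a); case: (i \in b); case: (i \in W) => //= ->.
Qed.

(** When the distance is odd, [u] and [a] are midpoints through the floor, [v] and [b] through the
    ceiling. *)
Lemma mutual_midpoints (d : nat) (a b : hypercube d) :
  exists u v : hypercube d,
    [/\ u \in midpoints a b, v \in midpoints a b,
        a \in midpoints u v & b \in midpoints u v].
Proof.
have [u [v [uv au bv av bu]]] := half_flip d a b.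
exists u, v; split.
- by apply: midpoints_half; rewrite // hdistC.
- by apply: midpoints_uphalf; rewrite // hdistC.
- by apply: midpoints_half; rewrite uv // hdistC.
- by apply: midpoints_uphalf; rewrite uv // hdistC.
Qed.

Lemma mem_midpoint_set (d : nat) (S T : {set hypercube d}) (s t u : hypercube d) :
  s \in S -> t \in T -> u \in midpoints s t -> u \in midpoint_set S T.
Proof.
by move=> Ss Tt ust; apply/bigcupP; exists s => //; apply/bigcupP; exists t.
Qed.

Lemma convex_endpoints (d : nat) (S : {set hypercube d}) (a b : hypercube d) :
  convex S -> midpoints a b \subset S -> a \in S /\ b \in S.
Proof.
move=> /subsetP cS /subsetP mS.
have [u [v [/mS Su /mS Sv auv buv]]] := mutual_midpoints d a b.
by split; apply: cS; [apply: mem_midpoint_set auv | apply: mem_midpoint_set buv].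
Qed.

Theorem corollary3p4 (d : nat) (A B : {set hypercube d})
    (hA : A != set0) (hB : B != set0) :
  A :|: B \subset convex_closure (midpoint_set A B).
Proof.
(* Nonemptiness gives every point of either set a partner in the other. *)
have [a0 Aa0] := set0Pn _ hA; have [b0 Bb0] := set0Pn _ hB.
apply/bigcapsP => S /andP[cS /subsetP mS].
have endpoints a b : a \in A -> b \in B -> a \in S /\ b \in S.
  move=> Aa Bb; apply: convex_endpoints => //.
  by apply/subsetP => u uab; apply: mS; apply: mem_midpoint_set uab.
apply/subsetP => x /setUP[Ax | Bx].
- by have [] := endpoints x b0 Ax Bb0.
- by have [] := endpoints a0 x Aa0 Bx.
Qed.
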